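(* Let $e \equiv a_1 x_1 + \dots + a_n x_n$ be a linear expression in integer variables with integer coefficients $a_i > 0$, and let $m_i$ be an integer (the current minimum of $x_i$) for each $i$. Let $M = [x_{i_1} = d_{i_1}, \dots, x_{i_n} = d_{i_n}]$ be the matching produced by the greedy procedure $\mathtt{calculateImprovedMinimum}$ (described in the context) applied to $e$ with lower bounds $m_1,\dots,m_n$, and let $\mathit{min} = \sum_{j=1}^n a_{i_j} d_{i_j}$. Then for every integer $n$-tuple $\mathbf{d} = (d_1,\dots,d_n)$ such that $d_i \ge m_i$ for all $i$ and $d_i \ne d_j$ for all $i \ne j$, we have $\sum_{i=1}^n a_i d_i \ge \mathit{min}$.
   Context: The greedy procedure $\mathtt{calculateImprovedMinimum}$, given $e \equiv a_1x_1+\dots+a_nx_n$ with $a_i>0$ and integer lower bounds $m_i$ for the $x_i$, works as follows. Initially all variables are unassigned, $M$ is the empty sequence, and $d := \min(m_1,\dots,m_n) - 1$. Then $n$ times: let $d$ be the smallest integer strictly greater than the current $d$ for which there exists at least one unassigned variable $x_i$ with $m_i \le d$ (such variables are called the candidates for $d$); among the candidates choose the one with the greatest coefficient $a_i$, breaking ties by choosing the smallest index $i$; mark it assigned and append the assignment $x_i = d$ to $M$. The resulting $M$ assigns pairwise distinct values, listed in increasing order, to all variables, with each $x_i$ receiving a value $\ge m_i$. *)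

(* Defs.v *)
From HB Require Import structures.
From mathcomp Require Import all_boot all_order all_algebra.
From mathcomp Require Import zify.

Set Implicit Arguments.
Unset Strict Implicit.
Unset Printing Implicit Defensive.

Import Order.TTheory GRing.Theory Num.Theory.
Local Open Scope ring_scope.

Section Greedy.

Variables (n : nat) (a m : 'I_n -> int).

Implicit Types (U C : {set 'I_n}) (d : int)
  (M : seq ('I_n * int)).

(* U is the set of currently unassigned variables. *)
Definition candidates U d : {set 'I_n} := [set i in U | m i <= d].

Lemma ex_candidates U d i :
  i \in U -> exists k : nat, candidates U (d + k.+1%:Z) != set0.
Proof.
move=> Ui; exists `|m i - d|%N; apply/set0Pn; exists i.
by rewrite inE Ui /=; lia.
Qed.

(* The smallest integer above d that has a candidate; integers above d are
   written d + k.+1 so that ex_minn applies.  The value d when U is empty is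
   junk: the procedure never queries it. *)
Definition next_value U d : int :=
  if set_0Vmem U is inr (exist i Ui)
  then d + (ex_minn (ex_candidates d Ui)).+1%:Z
  else d.

Definition preferred (i j : 'I_n) : bool :=
  (a j < a i) || ((a i == a j) && (i <= j)%N).

(* None only if C is empty. *)
Definition select C : option 'I_n :=
  [pick i in C | [forall j in C, preferred i j]].

Fixpoint greedy (k : nat) U d M : seq ('I_n * int) :=
  if k is k'.+1 then
    let d' := next_value U d in
    if select (candidates U d') is Some i
    then greedy k' (U :\ i) d' (rcons M (i, d'))
    else M
  else M.

End Greedy.

(* The pair (i, d) in the result stands for the assignment x_i = d.  There are
   n.+1 variables, so that the minimum of the bounds exists. *)
Definition calculateImprovedMinimum (n : nat) (a m : 'I_n.+1 -> int) :
    seq ('I_n.+1 * int) :=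
  greedy a m n.+1 [set: 'I_n.+1] (\big[Num.min/m ord0]_i m i - 1) [::].

(* Main.v *)
(** Exchange argument.  The step of the procedure that assigns [d'] to [i]
    replaces a competing injective assignment [f] of the unassigned variables,
    with values [>= d'], by one that gives [d'] to [i] and the old value [f i]
    to the variable that had [d'], if any.  That variable is then a candidate
    for [d'], so its coefficient is at most [a i] and the exchange does not
    increase the sum. *)
Require Import Defs.
From HB Require Import structures.
From mathcomp Require Import all_boot all_order all_algebra.
From mathcomp Require Import zify.

Set Implicit Arguments.
Unset Strict Implicit.
Unset Printing Implicit Defensive.

Import Order.TTheory GRing.Theory Num.Theory.
Local Open Scope ring_scope.

Section GreedyOptimality.

Variables (n : nat) (a m : 'I_n -> int).

Implicit Types (U C : {set 'I_n}) (d : int) (f : 'I_n -> int).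

Lemma next_valueP U d : U != set0 ->
  [/\ d < next_value m U d,
      candidates m U (next_value m U d) != set0
    & forall e, d < e -> candidates m U e != set0 -> next_value m U d <= e].
Proof.
rewrite /next_value; case: set_0Vmem => [->|[i Ui] _]; first by rewrite eqxx.
case: ex_minnP => k Ck kmin; split=> // [|e lt_de Ce]; first by lia.
have eE : e = d + (`|e - d|%N.-1).+1%:Z by lia.
have := kmin `|e - d|%N.-1; rewrite -eE => /(_ Ce); lia.
Qed.

Lemma selectP C : C != set0 ->
  exists i, [/\ select a C = Some i, i \in C & {in C, forall j, a j <= a i}].
Proof.
case/set0Pn=> i0 Ci0; rewrite /select; case: pickP => [i /andP[Ci]|noC].
  move=> /forall_inP pref; exists i; split=> // j /pref.
  by case/orP=> [/ltW//|/andP[/eqP-> _]].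
(* [select] cannot fail: among the elements of [C] with the greatest coefficient, the one of least
   index is preferred to all of [C]. *)
case: (@arg_maxP _ _ _ i0 [in C] a Ci0) => i1 Ci1 max1.
have i1P : (i1 \in C) && (a i1 == a i1) by rewrite Ci1 /=.
case: (@arg_minnP _ i1 [pred i | (i \in C) && (a i == a i1)] val i1P) => i.
move=> /andP[Ci /eqP ai] min_i.
have /negP[] := negbT (noC i); rewrite Ci; apply/forall_inP => j Cj.
rewrite /preferred ai; have: a j <= a i1 := max1 j Cj; rewrite le_eqVlt.
case/orP=> [/eqP aj|->//]; apply/orP; right.
by rewrite aj eqxx min_i //= Cj aj /=.
Qed.

Lemma exchange_sum U f d i :
  i \in U -> d <= f i -> {in U &, injective f} ->
  {in U, forall j, f j = d -> a j <= a i} -> 0 <= a i ->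
  a i * d + \sum_(j in U :\ i) a j * (if f j == d then f i else f j)
    <= \sum_(j in U) a j * f j.
Proof.
move=> Ui le_d injf maxi ai0; rewrite [leRHS](big_setD1 i) //=.
case: (pickP [pred j in U :\ i | f j == d]) => [j|nod]; last first.
  (* Nothing in [U :\ i] has the value [d], so only the term of [i] changes. *)
  rewrite lerD ?ler_wpM2l // le_eqVlt; apply/orP; left; apply/eqP.
  by apply: eq_bigr => j Uj; move: (nod j); rewrite /= Uj /= => ->.
case/andP=> Uj /eqP fj.
have [_ jU] := setD1P Uj.
rewrite [in leLHS](big_setD1 j) //= [in leRHS](big_setD1 j) //= fj eqxx.
rewrite (eq_bigr (fun k => a k * f k)) => [|k /setD1P[kj /setD1P[_ kU]]].
  (* The right side exceeds the left by [(a i - a j) * (f i - d)], a product of nonnegative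
     factors. *)
  rewrite !addrA lerD2r; have := maxi j jU fj; nia.
by case: eqP => // fk; rewrite (injf k j) ?eqxx ?fk ?fj in kj.
Qed.

(** Stated for any state of the loop and with [f] constrained only on [U], because the induction
    passes to the exchanged assignment on [U :\ i]. The bound [d < f i] is the invariant that makes
    the next value a lower bound for [f]. *)
Lemma greedy_le k U d M f :
  {in U, forall i, 0 <= a i} -> #|U| = k -> {in U &, injective f} ->
  {in U, forall i, m i <= f i} -> {in U, forall i, d < f i} ->
  \sum_(p <- greedy a m k U d M) a p.1 * p.2
    <= \sum_(p <- M) a p.1 * p.2 + \sum_(i in U) a i * f i.
Proof.
elim: k U d M f => [|k IHk] U d M f a_ge0 cardU injf m_le d_lt /=.
  by move/eqP: cardU; rewrite cards_eq0 => /eqP->; rewrite big_set0 addr0.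
have U0 : U != set0 by rewrite -card_gt0 cardU.
have [_ C0 next_min] := next_valueP d U0.
set d' := next_value m U d in C0 next_min *.
(* Each [j] in [U] is itself a candidate for [f j], which is above [d]. *)
have d'_le : {in U, forall j, d' <= f j}.
  move=> j Uj; apply: next_min; first exact: d_lt.
  by apply/set0Pn; exists j; rewrite inE Uj m_le.
have [i [-> /setIdP[Ui mi] maxi]] := selectP C0.
pose f' j := if f j == d' then f i else f j.
apply: le_trans (IHk _ _ _ f' _ _ _ _ _) _.
- by move=> j /setD1P[_]; apply: a_ge0.
- by move: cardU; rewrite (cardsD1 i) Ui => -[].
- move=> j l /setD1P[ji Uj] /setD1P[li Ul]; rewrite /f'.
  case: eqP => fj; case: eqP => fl.
  + by move=> _; apply: injf => //; rewrite fj.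
  + by move/(injf _ _ Ui Ul) => il; rewrite il eqxx in li.
  + by move/(injf _ _ Uj Ui) => il; rewrite il eqxx in ji.
  + exact: injf.
(* If [j] receives [f i], then [m j <= f j = d' <= f i]. *)
- move=> j /setD1P[_ Uj]; rewrite /f'; case: eqP => [fj|_]; last exact: m_le.
  by rewrite (le_trans (m_le _ Uj)) // fj d'_le.
(* The bound becomes strict since [d'] is freed: if [f j = d'], then [f i] differs from [d'] by
   injectivity. *)
- move=> j /setD1P[ji Uj]; rewrite /f' lt_neqAle.
  case: (eqVneq (f j) d') => [fj|fj]; last by rewrite eq_sym fj d'_le.
  rewrite d'_le // andbT; apply/eqP => fi; move/eqP: ji; apply.
  by apply: injf => //; rewrite fj.
rewrite big_rcons /= -addrA lerD2l.
apply: exchange_sum => //; [exact: d'_le | | exact: a_ge0].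
by move=> j Uj fj; apply: maxi; rewrite inE Uj -fj m_le.
Qed.

End GreedyOptimality.

Theorem theorem3p2 (n : nat) (a m : 'I_n.+1 -> int)
    (a_gt0 : forall i, 0 < a i) :
  let M := calculateImprovedMinimum a m in
  let min := \sum_(p <- M) a p.1 * p.2 in
  forall d : 'I_n.+1 -> int,
    (forall i, m i <= d i) ->
    (forall i j, i != j -> d i != d j) ->
    \sum_i a i * d i >= min.
Proof.
move=> M min d m_le d_neq; rewrite /min /M /calculateImprovedMinimum.
apply: le_trans (greedy_le (f := d) _ _ _ _ _ _) _.
- by move=> i _; apply: ltW.
- by rewrite cardsT card_ord.
- by move=> i j _ _ dij; apply: contra_eq (d_neq i j) _ => //; rewrite dij.
- by [].
(* The starting value is one below the least bound, hence strictly below every [d i]. *)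
- move=> i _; apply: lt_le_trans (m_le i).
  by rewrite ltrBlDr ltzD1 bigmin_le_cond.
by rewrite big_nil add0r (eq_bigl xpredT) // => i; rewrite inE.
Qed.
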